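(* Given any natural numbers $k,r,d$, there exists a number $W(r,k,d)$ such that, no matter how we colour $\mathbb{Z}^d$ with $r$ colours, for each $N \geq W(r,k,d)$ we can find a monochromatic $d$-dimensional grid $[k_1,\dots,k_d;l_1,\dots,l_d;k] \subseteq [N]^d$ of depth $k$.
   Context: For $N\in\mathbb{N}$, $[N]:=\{0,1,2,\dots,N\}$, and $[N]^d$ is the Cartesian product of $d$ copies of $[N]$. A $d$-dimensional grid of depth $n$ is a set of the form $[k_1,\dots,k_d;l_1,\dots,l_d;n]:=\{(l_1+m_1k_1,\,l_2+m_2k_2,\dots,l_d+m_dk_d) : m_1,\dots,m_d\in[n]\}$ for some fixed positive integers $k_1,\dots,k_d$ and fixed integers $l_1,\dots,l_d$. A colouring with $r$ colours is a map to an $r$-element set; a set is monochromatic if the colouring is constant on it. *)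

(* Defs.v *)
From mathcomp Require Import all_boot all_order all_algebra.
From mathcomp Require Import classical_sets.

Set Implicit Arguments.
Unset Strict Implicit.
Unset Printing Implicit Defensive.

Import Order.TTheory GRing.Theory Num.Theory.

Local Open Scope classical_set_scope.
Local Open Scope ring_scope.

(* [N] = {0, 1, ..., N}, with both endpoints included. *)
Definition segment (N : nat) : set int := [set z | 0 <= z <= N%:Z].

Definition cube (d N : nat) : set 'rV[int]_d :=
  [set x | forall i, segment N (x 0 i)].

(* [k_1,...,k_d; l_1,...,l_d; n]; positivity of the steps k_i is required
   separately where the notion is used. *)
Definition grid (d : nat) (k l : 'rV[int]_d) (n : nat) : set 'rV[int]_d :=
  [set \row_i (l 0 i + m 0 i * k 0 i) | m in @cube d n].

Definition monochromatic (T C : Type) (c : T -> C) (A : set T) : Prop :=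
  forall x y, A x -> A y -> c x = c y.

(* Main.v *)
Require Import Defs.
From mathcomp Require Import all_boot all_order all_algebra.
From mathcomp Require Import classical_sets.
From mathcomp Require Import zify.

(** The grid theorem follows from van der Waerden's theorem on monochromatic
    arithmetic progressions by induction on the dimension.  Suppose that [M]^d
    is large enough for grids of depth k.  A colouring c of (d+1)-dimensional
    space colours each natural number x by the whole pattern that c induces on
    the slice {x} * [M]^d; there are finitely many patterns, so van der Waerden
    ([van_der_waerden]) yields a progression of x's whose slices all carry the
    same pattern.  A monochromatic d-dimensional grid in one of these slices
    then occurs in all of them, and its product with the progression is a
    monochromatic (d+1)-dimensional grid ([exists_monochromatic_grid]).  The
    steps along different axes may differ, which is why the one-dimensional
    theorem suffices.

    Van der Waerden's theorem is proved by colour focusing ([colour_focusing]).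
    A family of progressions of the same length, each monochromatic in its own
    colour, is focused at a if each of them is continued downwards by the term
    a.  Either the colour of a is that of one of them, which is thereby
    lengthened, or a brings a new colour; and applying the theorem for shorter
    progressions to a colouring of blocks turns s focused progressions into
    s + 1.  This cannot go on once s is the number of colours. *)

Local Open Scope classical_set_scope.
Local Open Scope ring_scope.

Import Order.TTheory GRing.Theory Num.Theory.

(** * Van der Waerden's theorem *)

(** The bound says that the progression of k + 1 terms fits into W when each
    term is given room e; unlike a bound on the last term, it controls e even
    if k = 0. *)
Definition monochromatic_progression {C : Type} (f : nat -> C) (k W : nat) :=
  exists a e : nat,
    [/\ (0 < e)%N, (a + k.+1 * e <= W)%N
      & forall i, (i <= k)%N -> f (a + i * e)%N = f a].

(** The progressions a + e, ..., a + k.+1 * e (for e in es) have k + 1 terms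
    each and would be continued downwards by their common focus a.  The colour
    of a is required to be new too, so that the last condition exhibits s + 1
    colours. *)
Definition focused_progressions {C : eqType} (f : nat -> C) (k s W : nat) :=
  exists (a : nat) (es : seq nat),
    [/\ size es = s, (a < W)%N,
        forall e, e \in es -> (0 < e)%N /\ (a + k.+2 * e <= W)%N,
        forall e i, e \in es -> (i <= k)%N -> f (a + i.+1 * e)%N = f (a + e)%N
      & uniq (f a :: [seq f (a + e)%N | e <- es])].

Lemma monochromatic_progression_shift {C : Type} {f : nat -> C} {k : nat}
    (t W W' : nat) :
  (t + W <= W')%N -> monochromatic_progression (fun x => f (t + x)%N) k W ->
  monochromatic_progression f k W'.
Proof.
move=> le_tW [a [e [e_gt0 leW fE]]]; exists (t + a)%N, e.
by split=> [//||i le_ik]; [lia | rewrite -addnA fE].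
Qed.

(** Cut the numbers into blocks of length W, where W works for s.  The theorem
    for k gives a progression b + D, ..., b + k.+1 * D of equally coloured
    blocks, the first of which contains s progressions focused at some p.  In
    block b the copy of p becomes the new focus: an old step e is replaced by
    D * W + e, which moves D blocks further at each term, and the copies of p
    itself form one more progression, with step D * W. *)
Lemma colour_focusing {k : nat} :
  (forall C : finType, exists W, forall f : nat -> C,
     monochromatic_progression f k W) ->
  forall (C : finType) (s : nat), exists W, forall f : nat -> C,
    monochromatic_progression f k.+1 W \/ focused_progressions f k s W.
Proof.
move=> vdW C; elim=> [|s [W IHs]].
  by exists 1%N => f; right; exists 0%N, [::].
have [W1 W1P] := vdW {ffun 'I_W -> C}.
exists ((2 * W1).+1 * W)%N => f.
(* Only blocks from W1 on are searched, to leave room for block b, which lies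
   below the first term of the progression of blocks. *)
have [b' [D [D_gt0 leW1 blockE]]] :=
  W1P (fun x => [ffun j : 'I_W => f ((W1 + x) * W + j)%N]).
have [b bE] : exists b, (b + D = W1 + b')%N by exists (W1 + b' - D)%N; nia.
have leb : (b + k.+2 * D <= 2 * W1)%N by lia.
have copyE i x : (i <= k)%N -> (x < W)%N ->
    f ((b + i.+1 * D) * W + x)%N = f ((b + D) * W + x)%N.
  move=> le_ik lt_xW; have /ffunP/(_ (Ordinal lt_xW)) := blockE i le_ik.
  rewrite !ffunE /= -bE => <-; congr f; nia.
case: (IHs (fun x => f ((b + D) * W + x)%N)) => [mono|].
  by left; apply: monochromatic_progression_shift mono; nia.
move=> [p [es [size_es lt_pW esW esE es_uniq]]].
pose a := (b * W + p)%N; pose es' := (D * W)%N :: [seq (D * W + e)%N | e <- es].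
have aE e : (a + (D * W + e) = (b + D) * W + (p + e))%N by rewrite /a; nia.
have es'W e : e \in es' -> (0 < e)%N /\ (a + k.+2 * e <= (2 * W1).+1 * W)%N.
  have leW : ((b + k.+2 * D) * W <= 2 * W1 * W)%N by rewrite leq_mul2r leb orbT.
  rewrite inE => /predU1P[->|/mapP[e0 /esW[e0_gt0 le_e0] ->]]; split; nia.
have es'E e i : e \in es' -> (i <= k)%N -> f (a + i.+1 * e)%N = f (a + e)%N.
  rewrite inE => /predU1P[->|/mapP[e0 e0_es ->]] le_ik.
    have -> : (a + i.+1 * (D * W) = (b + i.+1 * D) * W + p)%N by rewrite /a; nia.
    by rewrite copyE // -[(D * W)%N]addn0 aE addn0.
  have [e0_gt0 le_e0] := esW _ e0_es.
  have -> : (a + i.+1 * (D * W + e0) = (b + i.+1 * D) * W + (p + i.+1 * e0))%N.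
    by rewrite /a; nia.
  rewrite copyE //; last by nia.
  by rewrite esE // aE.
have coloursE : [seq f (a + e)%N | e <- es'] =
    f ((b + D) * W + p)%N :: [seq f ((b + D) * W + (p + e))%N | e <- es].
  rewrite /= -[(D * W)%N]addn0 aE addn0 -map_comp; congr cons.
  by apply: eq_map => e /=; rewrite addn0 aE.
have [/mapP[e e_es' fa]|fa_new] := boolP (f a \in [seq f (a + e)%N | e <- es']).
  have [e_gt0 leW] := es'W e e_es'.
  left; exists a, e; split=> // -[|i] le_ik; first by rewrite addn0.
  by rewrite es'E.
right; exists a, es'; split=> //.
- by rewrite /= size_map size_es.
- by rewrite /a; nia.
- by rewrite cons_uniq fa_new coloursE.
Qed.

Theorem van_der_waerden (k : nat) (C : finType) :
  exists W, forall f : nat -> C, monochromatic_progression f k W.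
Proof.
elim: k C => [|k IHk] C.
  by exists 1%N => f; exists 0%N, 1%N; split=> // -[].
have [W WP] := colour_focusing IHk C #|C|.
exists W => f; case: (WP f) => // -[a [es [size_es _ _ _ es_uniq]]].
have := max_card (mem (f a :: [seq f (a + e)%N | e <- es])).
by rewrite (card_uniqP es_uniq) /= size_map size_es ltnn.
Qed.

(** * Grids *)

Lemma subset_cube {d M N : nat} : (M <= N)%N -> @cube d M `<=` @cube d N.
Proof.
move=> leMN x xM i; have /andP[x_ge0 x_leM] := xM i.
by apply/andP; split=> //; apply: le_trans x_leM _; rewrite lez_nat.
Qed.

Lemma segment_natP {N : nat} {z : int} :
  segment N z -> exists2 n : nat, (n <= N)%N & z = n%:Z.
Proof. by case: z => // n /andP[_ le_nN]; exists n. Qed.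

Definition int_row {d N : nat} (v : 'rV['I_N]_d) : 'rV[int]_d :=
  map_mx (fun j : 'I_N => (j : nat)%:Z) v.

Lemma cube_ordP {d N : nat} {x : 'rV[int]_d} :
  @cube d N x -> exists v : 'rV['I_N.+1]_d, x = int_row v.
Proof.
move=> xN; exists (\row_i inord (absz (x 0 i))); apply/rowP => i; rewrite !mxE.
by have [n le_nN ->] := segment_natP (xN i); rewrite absz_nat inordK.
Qed.

(** Induction on d.  The slice colours are finite functions, so the number of
    colours to which van der Waerden's theorem is applied depends on M, the
    bound for dimension d; hence that bound must be chosen uniformly in c. *)
Theorem exists_monochromatic_grid (k d : nat) (C : finType) :
  exists W, forall c : 'rV[int]_d -> C, exists ks ls : 'rV[int]_d,
    [/\ forall i, 0 < ks 0 i, grid ks ls k `<=` @cube d W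
      & monochromatic c (grid ks ls k)].
Proof.
elim: d => [|d [M IHd]].
  exists 0%N => c; exists 0, 0; split=> [[]//|x _ []//|x y _ _].
  by rewrite (thinmx0 x) (thinmx0 y).
have [W WP] := van_der_waerden k {ffun 'rV['I_M.+1]_d -> C}.
exists (maxn W M) => c.
pose slice (x : int) (y : 'rV[int]_d) : 'rV[int]_(1 + d) := row_mx x%:M y.
have slice0E x y : slice x y 0 (lshift d (0 : 'I_1)) = x.
  by rewrite row_mxEl mxE eqxx.
have slice_rshiftE x y j : slice x y 0 (rshift 1 j) = y 0 j.
  by rewrite row_mxEr.
have [a [e [e_gt0 leW sliceE]]] :=
  WP (fun x => [ffun v => c (slice x%:Z (int_row v))]).
have [ks [ls [ks_gt0 gridM monoM]]] := IHd (fun y => c (slice a%:Z y)).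
(* The first coordinate of a point of the product grid is a term a + i * e of
   the progression; the others form a point of the grid in the slice. *)
have gridP x : grid (slice e%:Z ks) (slice a%:Z ls) k x ->
    exists i y, [/\ (i <= k)%N, grid ks ls k y & x = slice (a + i * e)%N%:Z y].
  move=> [m mk <-].
  have [i le_ik m0E] := segment_natP (mk (lshift d (0 : 'I_1))).
  exists i, (\row_j (ls 0 j + m 0 (rshift 1 j) * ks 0 j)); split=> //.
    exists (\row_j m 0 (rshift 1 j)); first by move=> j; rewrite mxE; apply: mk.
    by apply/rowP => j; rewrite !mxE.
  apply/rowP => j; case: (@split_ordP 1 d j) => j' ->; rewrite mxE.
    rewrite ord1 !slice0E m0E; lia.
  by rewrite !slice_rshiftE mxE.
exists (slice e%:Z ks), (slice a%:Z ls); split.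
- move=> j; case: (@split_ordP 1 d j) => j' ->.
    by rewrite ord1 slice0E.
  by rewrite slice_rshiftE.
- move=> x /gridP[i [y [le_ik y_grid ->]]] j.
  case: (@split_ordP 1 d j) => j' ->.
    rewrite ord1 slice0E /segment /=; nia.
  rewrite slice_rshiftE; apply: (subset_cube (leq_maxr W M)); exact: gridM.
- have cE x : grid (slice e%:Z ks) (slice a%:Z ls) k x ->
      exists2 y, grid ks ls k y & c x = c (slice a%:Z y).
    move=> /gridP[i [y [le_ik y_grid ->]]]; exists y => //.
    have [v ->] := cube_ordP (gridM y y_grid).
    by have /ffunP/(_ v) := sliceE i le_ik; rewrite !ffunE.
  by move=> x x' /cE[y y_grid ->] /cE[y' y'_grid ->]; apply: monoM.
Qed.

Theorem theorem2p8 (k r d : nat) :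
  exists W : nat,
    forall (C : finType) (c : 'rV[int]_d -> C), #|C| = r ->
    forall N : nat, (W <= N)%N ->
    exists ks ls : 'rV[int]_d,
      [/\ forall i, 0 < ks 0 i,
          grid ks ls k `<=` @cube d N
        & monochromatic c (grid ks ls k)].
Proof.
(* A bound that depends on r only is obtained by renaming the colours. *)
have [W WP] := exists_monochromatic_grid k d 'I_r.
exists W => C c cardC N le_WN.
have [ks [ls [ks_gt0 gridW mono]]] :=
  WP (fun x => cast_ord cardC (enum_rank (c x))).
exists ks, ls; split=> // [x /gridW|x y x_grid y_grid]; first exact: subset_cube.
by apply/enum_rank_inj/(@cast_ord_inj _ _ cardC)/mono.
Qed.
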